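(* Let $0<d_1<\cdots<d_k<n$ be integers. Then there is the following decomposition: $$\mathbb{F}_{d_1<\cdots<d_k}(\mathbb{C}^n)=\bigsqcup_{\mathbf{M}\in\mathcal{M}^{d_1,\dots,d_k}_n}\mathbb{F}_{\mathbf{M}}.$$
   Context: A decomposition of a topological space $X$ is a family $\{X_i\}_{i\in I}$ of pairwise disjoint, locally closed subsets of $X$ with $X=\bigsqcup_{i\in I}X_i$ (members may be empty). $[n]=\{1,\dots,n\}$ and $\binom{[n]}{d}$ is the set of $d$-element subsets of $[n]$. A matroid of rank $d$ on $n$ elements is a pair $M=([n],\mathcal{B})$ with $\emptyset\neq\mathcal{B}\subset\binom{[n]}{d}$ such that for all $I,J\in\mathcal{B}$ and $i\in I\setminus J$ there is $j\in J\setminus I$ with $(I\setminus\{i\})\cup\{j\}\in\mathcal{B}$. $\mathcal{M}^d_n$ is the set of such matroids, and $\mathcal{M}^{d_1,\dots,d_k}_n=\mathcal{M}^{d_1}_n\times\cdots\times\mathcal{M}^{d_k}_n$; its elements are called plurimatroids. $G(d,n)$ is the Grassmannian of $d$-dimensional subspaces of $\mathbb{C}^n$ with Plücker coordinates $(p_I)_{I\in\binom{[n]}{d}}$. For $M=([n],\mathcal{B})\in\mathcal{M}^d_n$, $G_M=\{W\in G(d,n): p_I(W)\neq0\Leftrightarrow I\in\mathcal{B}\}$. The flag variety is $\mathbb{F}_{d_1<\cdots<d_k}(\mathbb{C}^n)=\{W_1\subset\cdots\subset W_k\subset\mathbb{C}^n:\dim W_i=d_i\}\subset\prod_{i=1}^kG(d_i,n)$,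 with the Zariski topology. For $\mathbf{M}=(M_1,\dots,M_k)$, the thin Schubert cell is $\mathbb{F}_{\mathbf{M}}=\left(\prod_{i=1}^kG_{M_i}\right)\cap\mathbb{F}_{d_1<\cdots<d_k}(\mathbb{C}^n)$. *)

(* Defs.v *)
From HB Require Import structures.
From mathcomp Require Import all_boot all_order all_algebra.
From mathcomp Require Import boolp classical_sets functions.
From mathcomp Require Import filter topology.
From mathcomp Require mpoly.
(* The notations of mpoly clash with those of topology. *)
Import -(notations) mpoly.

Set Implicit Arguments.
Unset Strict Implicit.
Unset Printing Implicit Defensive.

Import GRing.Theory.

Local Open Scope ring_scope.
Local Open Scope classical_set_scope.

Definition locally_closed (X : topologicalType) (A : set X) : Prop :=
  exists U Z : set X, [/\ open U, closed Z & A = U `&` Z].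

Definition decomposition (X : topologicalType) (I : Type) (A : I -> set X) :
    Prop :=
  [/\ trivIset [set: I] A,
      forall i : I, locally_closed (A i)
    & \bigcup_(i in [set: I]) A i = [set: X]].

Definition dsubset (n d : nat) := {I : {set 'I_n} | #|I| == d}.

Definition matroid_axioms (n d : nat) (B : {set {set 'I_n}}) : bool :=
  [&& B != finset.set0,
      [forall I in B, #|I| == d]
    & [forall I in B, forall J in B, forall i in I :\: J,
         exists j in J :\: I, (j |: (I :\ i))%SET \in B]].

Record matroid (n d : nat) := Matroid {
  bases : {set {set 'I_n}};
  _ : matroid_axioms d bases
}.

HB.instance Definition _ n d := [isSub for @bases n d].
HB.instance Definition _ n d := [Finite of matroid n d by <:].

Definition plurimatroid (n k : nat) (d : 'I_k -> nat) : Type :=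
  forall i : 'I_k, matroid n (d i).

Record grassmannian (F : fieldType) (n d : nat) := Grassmannian {
  gr_space :> {vspace 'rV[F]_n};
  _ : \dim gr_space == d
}.

HB.instance Definition _ F n d := [isSub for @gr_space F n d].
HB.instance Definition _ F n d := [Choice of grassmannian F n d by <:].

Section Plucker.
Variables (F : fieldType) (n d : nat).

(* The j-th smallest element of I. *)
Definition dsubset_nth (I : dsubset n d) (j : 'I_d) : 'I_n :=
  enum_val (cast_ord (esym (eqP (valP I))) j).

(* Homogeneous coordinates: the rows of the matrix form the basis of W chosen
   by the library, and another basis would multiply all the coordinates of W
   by the same nonzero scalar. *)
Definition plucker (W : grassmannian F n d) (I : dsubset n d) : F :=
  \det (\matrix_(a < d, b < d) (vbasis W)`_a 0 (dsubset_nth I b)).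

Definition matroid_cell (M : matroid n d) : set (grassmannian F n d) :=
  [set W | forall I : dsubset n d, plucker W I != 0 <-> val I \in bases M].

End Plucker.

Section Flag.
Variables (F : fieldType) (n k : nat) (d : 'I_k -> nat).

Definition is_flag (W : {dffun forall i : 'I_k, grassmannian F n (d i)}) :
    bool :=
  [forall i : 'I_k, forall j : 'I_k, (i < j)%N ==> (W i <= W j)%VS].

Record flag_variety := Flag {
  flag_val :> {dffun forall i : 'I_k, grassmannian F n (d i)};
  _ : is_flag flag_val
}.

HB.instance Definition _ := [isSub for flag_val].
HB.instance Definition _ := [Choice of flag_variety by <:].

End Flag.

Section Zariski.
Variables (F : fieldType) (n k : nat) (d : 'I_k -> nat).

(* One variable for each Pluecker coordinate of each factor of the product of
   the Grassmannians; the polynomials use them through enum_val. *)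
Definition plucker_var : finType := {i : 'I_k & dsubset n (d i)}.

Definition plucker_poly := mpoly #|plucker_var| F.

Definition multihomogeneous (f : plucker_poly) : Prop :=
  exists e : 'I_k -> nat, forall m, m \in msupp f -> forall i : 'I_k,
    (\sum_(v < #|plucker_var| | tag (enum_val v) == i) m v)%N = e i.

Definition plucker_eval (W : flag_variety F n d) (f : plucker_poly) : F :=
  meval (fun v : 'I_#|plucker_var| =>
           plucker (W (tag (enum_val v))) (tagged (enum_val v))) f.

Definition zero_locus (S : set plucker_poly) : set (flag_variety F n d) :=
  [set W | forall f, S f -> plucker_eval W f = 0].

(* The topology induced by the closed embedding of the product of the
   Grassmannians into a product of projective spaces: the closed sets are the
   zero loci of sets of multihomogeneous polynomials. *)
Definition zariski_closed (A : set (flag_variety F n d)) : Prop :=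
  exists2 S : set plucker_poly,
    S `<=` multihomogeneous & A = zero_locus S.

Definition zariski_open (A : set (flag_variety F n d)) : Prop :=
  zariski_closed (~` A).

Lemma multihomogeneous1 : multihomogeneous 1.
Proof.
exists (fun=> 0%N) => m; rewrite msupp1 inE => /eqP-> i.
by rewrite big1// => v _; rewrite mnm0E.
Qed.

Lemma multihomogeneousM f g :
  multihomogeneous f -> multihomogeneous g -> multihomogeneous (f * g).
Proof.
move=> [e he] [e' he']; exists (fun i => e i + e' i)%N => m mfg i.
have /allpairsP[[m1 m2] /= [m1f m2g ->]] := msuppM_le mfg.
rewrite -(he _ m1f) -(he' _ m2g) -big_split/=.
by apply: eq_bigr => v _; rewrite mnmDE.
Qed.

Lemma zariski_openT : zariski_open setT.
Proof.
exists [set 1]; first by move=> _ ->; exact: multihomogeneous1.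
rewrite setCT; apply/esym/seteqP; split => // W /(_ 1 erefl) /eqP.
by rewrite /plucker_eval meval1 oner_eq0.
Qed.

Lemma zariski_openI : setI_closed zariski_open.
Proof.
move=> A B [S hS AE] [T hT BE].
exists [set h | exists f g, [/\ S f, T g & h = f * g]].
  by move=> _ [f [g [/hS hf /hT hg ->]]]; exact: multihomogeneousM.
rewrite setCI AE BE; apply/seteqP; split=> W.
  by case=> WZ _ [f [g [Sf Tg ->]]];
    rewrite /plucker_eval mevalM ?(WZ _ Sf) ?(WZ _ Tg);
    [have := WZ _ Sf|have := WZ _ Tg]; rewrite /plucker_eval => ->;
    rewrite ?mul0r ?mulr0.
move=> WZ; have [WS|/existsNP[f /not_implyP[Sf fN0]]] := pselect (zero_locus S W).
  by left.
right=> g Tg; have := WZ (f * g); rewrite /plucker_eval mevalM => /(_ _)/eqP.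
by rewrite mulf_eq0 (negbTE (introN eqP fN0)) => /(_ _)/eqP; apply; exists f, g.
Qed.

Lemma zariski_open_bigU (I : Type) (A : I -> set (flag_variety F n d)) :
  (forall i, zariski_open (A i)) -> zariski_open (\bigcup_i A i).
Proof.
move=> oA; exists [set f | multihomogeneous f /\
    exists i, ~` A i `<=` [set W | plucker_eval W f = 0]]; first by move=> f [].
apply/seteqP; split=> [W nAW f [_ [i]]|W WZ [i _ AiW]].
  by apply=> AiW; apply: nAW; exists i.
have [S hS AE] := oA i; suff : (~` A i) W by exact.
rewrite AE => f Sf; apply: WZ; split; first exact: hS.
by exists i; rewrite AE => V; exact.
Qed.

HB.instance Definition _ := isOpenTopological.Build (flag_variety F n d)
  zariski_openT zariski_openI zariski_open_bigU.

Definition thin_schubert_cell (M : plurimatroid n d) :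
    set (flag_variety F n d) :=
  [set W | forall i : 'I_k, matroid_cell (M i) (W i)].

End Zariski.

(* Main.v *)
Require Import Defs.
From mathcomp Require Import all_boot all_order all_algebra.
From mathcomp Require Import boolp classical_sets cardinality.
From mathcomp Require Import reals topology.
From mathcomp Require Import complex.
From mathcomp Require mpoly.
Import -(notations) mpoly.

(** The nonvanishing Pluecker coordinates of [W] are the sets [I] for which the
    columns indexed by [I] of a matrix with row space [W] form a basis. Such
    sets satisfy the exchange axiom: the columns of [J] span, so one of them
    lies outside the hyperplane spanned by the columns of [I :\ i]. Hence every
    flag lies in a thin Schubert cell, which is unique because the Pluecker
    coordinates determine the bases. Each cell is cut out by the vanishing of
    some Pluecker coordinates and the nonvanishing of finitely many others. *)

Set Implicit Arguments.
Unset Strict Implicit.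
Unset Printing Implicit Defensive.

Import GRing.Theory.

Section FreeFamilies.
Local Open Scope ring_scope.
Variable F : fieldType.

(** A relation among the rows is a row vector [u] with [u *m A = 0]. This trades matrix rank for
    freeness of families, which can be indexed by sets. *)
Lemma row_free_rows m n (A : 'M[F]_(m, n)) :
  row_free A = free [seq row i A | i <- enum 'I_m].
Proof.
have -> : [seq row i A | i <- enum 'I_m] = [tuple row i A | i < m] by [].
have rowE (i : 'I_m) : [tuple row i A | i < m]`_i = row i A.
  by rewrite -tnth_nth tnth_mktuple.
have sumE k : \sum_(i < m) k i *: [tuple row i A | i < m]`_i
              = (\row_i k i) *m A.
  by rewrite mulmx_sum_row; apply: eq_bigr => i _; rewrite rowE mxE.
apply/idP/freeP => [fA k|fA].
  rewrite sumE -[RHS](mul0mx _ A) => /(row_free_inj fA)/rowP k0 i.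
  by have := k0 i; rewrite !mxE.
rewrite -kermx_eq0; apply/rowV0P => u /sub_kermxP uA.
apply/rowP => i; rewrite mxE; apply: (fA (u 0)); rewrite sumE -[RHS]uA.
by congr (_ *m _); apply/rowP => j; rewrite mxE.
Qed.

Variables (T : finType) (vT : vectType F) (v : T -> vT).
Implicit Types I J : {set T}.

Lemma free_setU1 (x : T) I : x \notin I ->
  free [seq v y | y <- enum (x |: I)] =
  (v x \notin <<[seq v y | y <- enum I]>>%VS) && free [seq v y | y <- enum I].
Proof.
move=> xI; rewrite -free_cons; apply: perm_free.
rewrite -map_cons; apply: perm_map; apply: uniq_perm.
- exact: enum_uniq.
- by rewrite /= enum_uniq mem_enum xI.
- by move=> y; rewrite inE !mem_enum !inE.
Qed.

(** If every [v y] with [y] in [J] lay in the span of [I :\ x], that span would be everything and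
    would contain [v x], against the freeness of [I]. *)
Lemma free_exchange I J (x : T) :
    free [seq v y | y <- enum I] -> x \in I :\: J ->
    <<[seq v y | y <- enum J]>>%VS = fullv ->
  exists2 y, y \in J :\: I & free [seq v z | z <- enum (y |: I :\ x)].
Proof.
move=> fI /[!inE] /andP[xJ xI] spanJ.
have /andP[vx fIx] :
    (v x \notin <<[seq v y | y <- enum (I :\ x)]>>%VS)
    && free [seq v y | y <- enum (I :\ x)].
  by rewrite -free_setU1 ?finset.setD11// finset.setD1K.
have [y yJ vy] :
    exists2 y, y \in J & v y \notin <<[seq v y | y <- enum (I :\ x)]>>%VS.
  apply/exists_inP; apply: contraT => /exists_inPn vJ.
  case/negP: vx; have: v x \in fullv by exact: memvf.
  rewrite -spanJ; apply/subvP/span_subvP => _ /mapP[y + ->].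
  by rewrite mem_enum => /vJ; rewrite negbK.
have yIx : y \notin I :\ x.
  by apply: contra vy => yIx; apply/memv_span/map_f; rewrite mem_enum.
exists y; last by rewrite free_setU1// vy.
(* Outside [I :\ x], either [y] is outside [I] or [y = x]; the latter fails because [y] is in [J]
   and [x] is not. *)
rewrite inE yJ andbT; move: yIx; rewrite !inE negb_and negbK.
by case/orP => // /eqP yx; rewrite -yx yJ in xJ.
Qed.

End FreeFamilies.

Section PluckerMatroid.
Local Open Scope ring_scope.
Variables (F : fieldType) (n d : nat).
Implicit Types (W : grassmannian F n d) (I : dsubset n d).

Definition basis_mx W : 'M[F]_(d, n) := \matrix_(a < d) (vbasis W)`_a.

Definition basis_col W (i : 'I_n) : 'rV[F]_d := row i (basis_mx W)^T.

Lemma row_free_basis_mx W : row_free (basis_mx W).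
Proof.
rewrite row_free_rows.
have -> : [seq row a (basis_mx W) | a <- enum 'I_d] = vbasis W.
  have dW : size (vbasis W) = d by rewrite size_tuple; exact/eqP/(valP W).
  apply: (@eq_from_nth _ 0); rewrite size_map size_enum_ord// => a ad.
  by rewrite (nth_map (Ordinal ad)) ?size_enum_ord// rowK nth_enum_ord.
exact/basis_free/vbasisP.
Qed.

Lemma enum_dsubset_nth I :
  [seq dsubset_nth I b | b <- enum 'I_d] = enum (val I).
Proof.
have cI : #|val I| = d by exact/eqP/(valP I).
(* For [d = 0] there may be no element of ['I_n] to serve as the default of [nth], so this case is
   treated apart. *)
apply/esym; case: d I cI => [|d'] I cI.
  by rewrite enum_ord0/=; apply: size0nil; rewrite -cardE.
pose x0 := dsubset_nth I ord0.
apply: (@eq_from_nth _ x0); first by rewrite size_map size_enum_ord -cardE.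
rewrite -cardE cI => b bd.
rewrite (nth_map (Ordinal bd)) ?size_enum_ord//.
by rewrite /dsubset_nth (enum_val_nth x0)/= nth_enum_ord.
Qed.

(** The coordinate is a maximal minor; it is nonzero exactly when the transposed submatrix, whose
    rows are the chosen columns, is invertible. *)
Lemma plucker_neq0 W I :
  (plucker W I != 0) = free [seq basis_col W i | i <- enum (val I)].
Proof.
rewrite -enum_dsubset_nth -map_comp /plucker -det_tr -unitfE -unitmxE.
rewrite -row_free_unit row_free_rows; congr (free _); apply: eq_map => b /=.
by apply/rowP => a; rewrite !mxE.
Qed.

Lemma span_basis_col W I : plucker W I != 0 ->
  <<[seq basis_col W i | i <- enum (val I)]>>%VS = fullv.
Proof.
rewrite plucker_neq0 => /eqP dimI; apply/eqP.
rewrite -(dimv_leqif_eq (subvf _)) dimI size_map -cardE (eqP (valP I)).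
by rewrite dimvf /dim/= mul1n.
Qed.

Definition plucker_bases W : {set {set 'I_n}} :=
  [set val I | I in [pred I : dsubset n d | plucker W I != 0]].

Lemma mem_plucker_bases W I : (val I \in plucker_bases W) = (plucker W I != 0).
Proof. by rewrite mem_imset ?inE//; exact: val_inj. Qed.

Lemma plucker_basesP W (A : {set 'I_n}) :
  reflect (#|A| = d /\ free [seq basis_col W i | i <- enum A])
          (A \in plucker_bases W).
Proof.
apply: (iffP imsetP) => [[I + ->]|[cA fA]].
  by rewrite inE plucker_neq0 => fI; split=> //; exact/eqP/(valP I).
exists (exist _ A (introT eqP cA)) => //.
by rewrite inE plucker_neq0.
Qed.

(** The basis matrix has rank [d], so some [d] of its columns are independent; [fullrankfun] selects
    them. *)
Lemma plucker_bases_neq0 W : plucker_bases W != finset.set0.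
Proof.
have WT : row_full (basis_mx W)^T.
  by rewrite /row_full mxrank_tr; exact: row_free_basis_mx.
apply/set0Pn; exists [set fullrankfun WT b | b : 'I_d].
apply/plucker_basesP; split.
  by rewrite card_imset ?card_ord//; exact: fullrankfun_inj.
have := fullrowsub_free WT; rewrite row_free_rows => fW.
pose s := [seq fullrankfun WT b | b <- enum 'I_d].
(* The enumeration of the image may order the selected indices differently, which does not affect
   freeness. *)
rewrite (perm_free (Y := [seq basis_col W i | i <- s])).
  rewrite -map_comp; congr (free _): fW; apply: eq_map => b.
  by apply/rowP => a; rewrite !mxE.
apply: perm_map; apply: uniq_perm.
- exact: enum_uniq.
- by rewrite map_inj_uniq ?enum_uniq//; exact: fullrankfun_inj.
- move=> i; rewrite mem_enum; apply/imsetP/mapP => -[b _ ->]; exists b => //.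
  by rewrite mem_enum.
Qed.

Lemma plucker_matroid_axioms W : matroid_axioms d (plucker_bases W).
Proof.
apply/and3P; split; first exact: plucker_bases_neq0.
  by apply/forall_inP => A /plucker_basesP[-> _].
apply/forall_inP => A /plucker_basesP[cA fA].
apply/forall_inP => B /imsetP[J WJ ->]; apply/forall_inP => i iAJ.
have [j jJA fj] := free_exchange fA iAJ (span_basis_col WJ).
apply/exists_inP; exists j => //; apply/plucker_basesP; split => //.
move: iAJ jJA; rewrite !inE => /andP[_ iA] /andP[jA _].
by rewrite cardsU1 !inE (negPf jA) andbF -cA (cardsD1 i A) iA.
Qed.

Definition plucker_matroid W : matroid n d :=
  Matroid (plucker_matroid_axioms W).

Lemma matroid_cell_plucker W : matroid_cell (plucker_matroid W) W.
Proof. by move=> I; rewrite /= mem_plucker_bases. Qed.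

Lemma matroid_cell_inj (M N : matroid n d) W :
  matroid_cell M W -> matroid_cell N W -> M = N.
Proof.
move=> MW NW; apply/val_inj/setP => A.
have [cA|cA] := boolP (#|A| == d).
  by apply/idP/idP => AM; [apply/(NW (exist _ A cA))/MW|
                           apply/(MW (exist _ A cA))/NW].
(* The cell condition only concerns [d]-subsets; a set of another size is a basis of no matroid of
   rank [d]. *)
have basesF (L : matroid n d) : A \notin bases L.
  by case: L => B /= /and3P[_ /forall_inP cB _]; apply: contra cA => /cB.
by rewrite (negPf (basesF M)) (negPf (basesF N)).
Qed.

End PluckerMatroid.

Section ThinSchubertCells.
Local Open Scope ring_scope.
Local Open Scope classical_set_scope.
Variables (F : fieldType) (n k : nat) (d : 'I_k -> nat).

Lemma closed_plucker_eq0 (i : 'I_k) (I : dsubset n (d i)) :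
  closed [set W : flag_variety F n d | plucker (W i) I = 0].
Proof.
pose x : plucker_var n d := Tagged (fun i => dsubset n (d i)) I.
rewrite -openC /open/= /zariski_open setCK.
exists [set mpolyX F (mnm1 (enum_rank x))].
  move=> _ ->.
  (* A single variable has only one monomial, so its multidegree is read off that monomial. *)
  exists (fun j => \sum_(v < #|plucker_var n d| | tag (enum_val v) == j)
                     mnm1 (enum_rank x) v)%N => m + j.
  by rewrite msuppX inE => /eqP ->.
have evalE W : plucker_eval W (mpolyX F (mnm1 (enum_rank x))) = plucker (W i) I.
  by rewrite /plucker_eval mevalXU enum_rankK.
apply/seteqP; split=> W /=; first by move=> W0 _ ->; rewrite evalE.
by move=> /(_ _ erefl); rewrite evalE.
Qed.

Lemma locally_closed_thin_schubert_cell (M : plurimatroid n d) :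
  locally_closed (thin_schubert_cell (F := F) M).
Proof.
pose Z (x : plucker_var n d) :=
  [set W : flag_variety F n d | plucker (W (tag x)) (tagged x) = 0].
have cZ x : closed (Z x) by exact: closed_plucker_eq0.
pose in_bases :=
  [set x : plucker_var n d | val (tagged x) \in bases (M (tag x))].
(* The open part keeps the coordinates of bases nonzero, and the closed part makes the others
   vanish. The union is closed because there are finitely many coordinates. *)
exists (~` \bigcup_(x in in_bases) Z x), (\bigcap_(x in ~` in_bases) Z x).
split.
- by rewrite openC; apply: closed_bigcup => //; exact: finite_finset.
- exact: closed_bigI.
- apply/seteqP; split=> W.
    move=> MW; split.
      by case=> -[i I] /= /(MW i I)/eqP.
    case=> i I /= IM; apply/eqP; apply: contrapT => /negP WI.
    exact/IM/(MW i I).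
  move=> [WU WZ] i I; split=> [WI|IM].
    apply: contrapT => IM; move/eqP: WI; apply.
    exact: (WZ (Tagged (fun i => dsubset n (d i)) I)).
  apply/eqP => WI; apply: WU.
  by exists (Tagged (fun i => dsubset n (d i)) I).
Qed.

End ThinSchubertCells.

Theorem proposition3p4 (R : realType) (n k : nat) (d : 'I_k -> nat)
    (k_gt0 : (0 < k)%N)
    (d_bounds : forall i : 'I_k, (0 < d i < n)%N)
    (d_increasing : forall i j : 'I_k, (i < j)%N -> (d i < d j)%N) :
  decomposition (X := flag_variety R[i]%C n d)
    (fun M : plurimatroid n d => thin_schubert_cell M).
Proof.
split.
(* Two cells sharing a flag [W] have the same matroid in each component. *)
- move=> M N _ _ [W [MW NW]]; apply: functional_extensionality_dep => i.
  exact: matroid_cell_inj (MW i) (NW i).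
- exact: locally_closed_thin_schubert_cell.
- apply/seteqP; split=> // W _.
  by exists (fun i => plucker_matroid (W i)) => // i;
    exact: matroid_cell_plucker.
Qed.
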